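(* Let $W=\left(\bigoplus_{i\in\mathcal Q}\alpha_iW_i,\eta\right)$ be a direct sum of tournament kernels with $\sum_{i\in\mathcal Q}\alpha_i=1$. Then for every finite tournament $F$, $$t_{\mathrm{ind}}(F,W)=\sum_{(F_i)\in\mathcal P(F,\mathcal Q)}\prod_{i\in\mathcal Q}\alpha_i^{v(F_i)}\,t_{\mathrm{ind}}(F_i,W_i).$$
   Context: A tournament kernel on $(\mathcal S,\mu)$ is a measurable $W:\mathcal S^2\to[0,1]$ with $W(x,y)+W(y,x)=1$ a.e. For a finite tournament $F$ on $\{1,\dots,k\}$, $t_{\mathrm{ind}}(F,W)=\int_{\mathcal S^k}\prod_{(i,j)\in E(F)}W(x_i,x_j)\prod d\mu(x_i)$; for the empty tournament it is $1$; $0^0=1$. Direct sum with $\sum\alpha_i=1$: given a countable set $\mathcal Q$, $\alpha_i\ge0$ with $\sum\alpha_i=1$, tournament kernels $W_i$ on probability spaces $(\mathcal S_i,\mu_i)$, and an injective $\eta:\mathcal Q\to[0,1]$, the kernel $\left(\bigoplus\alpha_iW_i,\eta\right)$ lives on $\mathcal S=\bigsqcup_i\mathcal S_i$ with $\mu=\sum_i\alpha_i\mu_i$ and is $W(x,y)=W_i(x,y)$ for $x,y\in\mathcal S_i$, $W(x,y)=1$ if $x\in\mathcal S_i,y\in\mathcal S_j$ with $\eta(i)<\eta(j)$, and $0$ if $\eta(i)>\eta(j)$. Order $\mathcal Q$ by $\eta$. For a tournament $F$, $\mathcal P(F,\mathcal Q)$ is the set of families $(F_i)_{i\in\mathcal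 Q}$ of (possibly empty, all but finitely many empty) induced subtournaments of $F$ whose vertex sets partition $V(F)$ such that for $i<j$ every edge between $V(F_i)$ and $V(F_j)$ goes from $V(F_i)$ to $V(F_j)$. *)

(* Defs.v *)
From HB Require Import structures.
From mathcomp Require Import all_boot all_order all_algebra.
From mathcomp Require Import all_classical all_reals all_analysis.

Set Implicit Arguments.
Unset Strict Implicit.
Unset Printing Implicit Defensive.

Import Order.TTheory GRing.Theory Num.Theory.
Import numFieldNormedType.Exports.

Local Open Scope classical_set_scope.
Local Open Scope ring_scope.

Record tournament (k : nat) := Tournament {
  edge :> rel 'I_k ;
  edge_irr : forall u, ~~ edge u u ;
  edge_total : forall u v, u != v -> edge u v = ~~ edge v u }.

(* The subtournament of F induced by A, its vertices being relabelled in
   increasing order by 0, ..., #|A| - 1. *)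
Section induced_sub.
Variables (k : nat) (F : tournament k) (A : {set 'I_k}).

Let e : rel 'I_#|A| := fun i j => F (enum_val i) (enum_val j).

Let e_irr u : ~~ e u u.
Proof. exact: edge_irr. Qed.

Let e_total u v : u != v -> e u v = ~~ e v u.
Proof. by move=> uv; apply: edge_total; rewrite (inj_eq enum_val_inj). Qed.

Definition induced_sub : tournament #|A| := Tournament e_irr e_total.

End induced_sub.

Section tuple_cons.
Context d (T : measurableType d) (n : nat).

Definition tuple_cons (p : T * n.-tuple T) : n.+1.-tuple T :=
  [tuple of p.1 :: p.2].

Let measurable_tuple_cons : measurable_fun [set: T * n.-tuple T] tuple_cons.
Proof. exact: measurable_cons. Qed.

HB.instance Definition _ :=
  isMeasurableFun.Build _ _ _ _ tuple_cons measurable_tuple_cons.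

End tuple_cons.

Section power_measure.
Context d (T : measurableType d) (R : realType) (mu : probability T R).

Fixpoint power_measure (n : nat) : probability (n.-tuple T) R :=
  match n with
  | 0 => \d_([tuple] : 0.-tuple T)
  | m.+1 => distribution (mu \x power_measure m)%E (@tuple_cons d T m)
  end.

Lemma power_measureE n (A : 'I_n -> set T) : (forall i, measurable (A i)) ->
  power_measure n [set x | forall i, A i (tnth x i)] =
  (\prod_(i < n) mu (A i))%E.
Proof.
elim: n A => [|n ih] A mA /=.
  by rewrite big_ord0 diracE mem_set//; case.
rewrite /distribution /pushforward big_ord_recl -ih; last by move=> i.
rewrite -product_measure1E//; last first.
  rewrite (_ : mkset _ = \bigcap_(i in [set: 'I_n])
      ((fun x : n.-tuple T => tnth x i) @^-1` A (lift ord0 i))).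
    apply: fin_bigcap_measurable => // i _.
    by rewrite -[X in measurable X]setTI; exact: measurable_tnth.
  by apply/seteqP; split => [x h i _|x h i]; [exact: (h i)|exact: (h i Logic.I)].
congr (_ _); apply/seteqP; split => -[x y]/=.
  move=> h; split; first exact: (h ord0).
  by move=> i; have := h (lift ord0 i); rewrite /tuple_cons tnthS.
move=> [h0 h] i; case: (unliftP ord0 i) => [j ->|->//].
by rewrite /tuple_cons tnthS; exact: h.
Qed.

End power_measure.

Section kernel.
Context d (T : measurableType d) (R : realType) (mu : probability T R).

Definition tournament_kernel (W : T * T -> R) : Prop :=
  [/\ measurable_fun [set: T * T] W,
      forall z, 0 <= W z <= 1 &
      {ae (mu \x mu)%E, forall z, W (z.1, z.2) + W (z.2, z.1) = 1}].

Definition t_ind (k : nat) (F : tournament k) (W : T * T -> R) : \bar R :=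
  (\int[power_measure mu k]_x
    (\prod_(e : 'I_k * 'I_k | F e.1 e.2) W (tnth x e.1, tnth x e.2))%:E)%E.

End kernel.

Definition measure_dunion_display (I : Type) :
  (I -> measure_display) -> measure_display.
Proof. by move=> _; exact: default_measure_display. Qed.

(* An alias of the sigma-type, on which the library already has an unrelated
   instance of pointedType. *)
Definition dunion (I : pointedType) (d : I -> measure_display)
  (S : forall i, measurableType (d i)) : Type := {i & S i}.

Section dunion_measurable.
Context (I : pointedType) (d : I -> measure_display)
  (S : forall i, measurableType (d i)).

Definition dunion_in (i : I) (x : S i) : dunion S := existT (fun i => S i) i x.

HB.instance Definition _ := Choice.copy (dunion S) {i & S i}.
HB.instance Definition _ :=
  isPointed.Build (dunion S) (dunion_in (@point (S point))).

Definition dunion_measurable : set (set (dunion S)) :=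
  [set A | forall i, measurable (@dunion_in i @^-1` A)].

Let dunion_measurable0 : dunion_measurable set0.
Proof. by move=> i; rewrite preimage_set0. Qed.

Let dunion_measurableC A : dunion_measurable A -> dunion_measurable (~` A).
Proof. by move=> mA i; rewrite preimage_setC; exact: measurableC. Qed.

Let dunion_measurable_bigcup (F : (set (dunion S))^nat) :
  (forall n, dunion_measurable (F n)) -> dunion_measurable (\bigcup_n F n).
Proof.
move=> mF i; rewrite preimage_bigcup.
by apply: bigcupT_measurable => n; exact: mF.
Qed.

HB.instance Definition _ := @isMeasurable.Build (measure_dunion_display d)
  (dunion S) dunion_measurable
  dunion_measurable0 dunion_measurableC dunion_measurable_bigcup.

End dunion_measurable.

Arguments dunion_in {I d} S i x.

Section dsum_measure.
Context (I : pointedType) (d : I -> measure_display)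
  (S : forall i, measurableType (d i)) (R : realType).
Local Open Scope ereal_scope.

Definition dsum_measure (alpha : I -> R) (alpha_ge0 : forall i, (0 <= alpha i)%R)
    (alpha_sum : \esum_(i in [set: I]) (alpha i)%:E = 1)
    (mu : forall i, probability (S i) R) (A : set (dunion S)) : \bar R :=
  \esum_(i in [set: I]) (alpha i)%:E * mu i (dunion_in S i @^-1` A).

Variables (alpha : I -> R) (alpha_ge0 : forall i, (0 <= alpha i)%R)
  (alpha_sum : \esum_(i in [set: I]) (alpha i)%:E = 1)
  (mu : forall i, probability (S i) R).

Local Notation m := (dsum_measure alpha_ge0 alpha_sum mu).

Let term_ge0 i A : 0 <= (alpha i)%:E * mu i A.
Proof. by rewrite mule_ge0// lee_fin. Qed.

Let m0 : m set0 = 0.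
Proof.
by rewrite /dsum_measure esum1// => i _; rewrite preimage_set0 measure0 mule0.
Qed.

Let m_ge0 A : 0 <= m A.
Proof. exact: esum_ge0. Qed.

Let m_sigma_additive : semi_sigma_additive m.
Proof.
move=> F mF tF mUF; have -> : m (\bigcup_n F n) = \sum_(n <oo) m (F n).
  rewrite nneseries_esumT// /dsum_measure.
  transitivity (\esum_(i in [set: I]) \esum_(n in [set: nat])
      (alpha i)%:E * mu i (dunion_in S i @^-1` F n)).
    apply: eq_esum => i _; rewrite preimage_bigcup.
    rewrite measure_semi_bigcup//.
    - rewrite -nneseriesZl// nneseries_esumT// => n.
      exact: term_ge0.
    - by move=> n; exact: mF.
    - apply/trivIsetP => a b _ _ ab; rewrite -preimage_setI.
      by move/trivIsetP : tF => ->//; rewrite preimage_set0.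
  rewrite !esum_esum//.
  rewrite (@reindex_esum _ _ _ ([set: nat] `*`` (fun=> [set: I])) _
    (fun x => (x.2, x.1)))//.
  split=> [[]//|[a b] [c e] _ _ [-> ->]//|[a b] _].
  by exists (b, a).
by apply: is_cvg_nneseries => n _ _; exact: m_ge0.
Qed.

HB.instance Definition _ :=
  isMeasure.Build _ _ _ m m0 m_ge0 m_sigma_additive.

Let m_setT : m setT = 1.
Proof.
rewrite /dsum_measure -[RHS]alpha_sum; apply: eq_esum => i _.
by rewrite preimage_setT probability_setT mule1.
Qed.

HB.instance Definition _ := Measure_isProbability.Build _ _ _ m m_setT.

End dsum_measure.

(* Since eta is injective, the last case means eta (tag z.1) > eta (tag z.2). *)
Definition dsum_kernel (I : pointedType) (d : I -> measure_display)
    (S : forall i, measurableType (d i)) (R : realType) (eta : I -> R)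
    (W : forall i, S i * S i -> R) (z : dunion S * dunion S) : R :=
  if tag z.1 == tag z.2 then W (tag z.1) (tagged z.1, tagged_as z.1 z.2)
  else if eta (tag z.1) < eta (tag z.2) then 1 else 0.

(* A family of induced subtournaments is given by its vertex sets. *)
Definition split_families (k : nat) (F : tournament k) (I : pointedType)
    (R : realType) (eta : I -> R) : set (I -> {set 'I_k}) :=
  [set A : I -> {set 'I_k} |
    [/\ finite_set [set i | A i <> finset.set0],
        forall i j, i <> j -> A i :&: A j = finset.set0,
        forall v, exists i, v \in A i &
        forall i j, eta i < eta j -> forall u v,
          u \in A i -> v \in A j -> F u v]].

(* Main.v *)
From HB Require Import structures.
Require Import Defs.
From mathcomp Require Import all_boot all_order all_algebra.
From mathcomp Require Import all_classical all_reals all_analysis.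
From mathcomp Require Import measurable_realfun.

(** Colour each vertex of F by the index of the component of the direct sum
    that contains its image. The k-th power of the direct sum splits into
    countably many cells, one per colouring c. On a cell where some edge of F
    goes against the order of the colours, the integrand vanishes; on the other
    cells the colour classes of c form a family in P(F, Q), every edge between
    two classes contributes a factor 1, and the integrand is a product over the
    colours i of functions of the coordinates of colour i only. By Fubini the
    integral over the cell is then a product of integrals over powers of the
    direct sum, and restricting the direct sum to component i yields
    alpha_i times mu_i. *)

Set Implicit Arguments.
Unset Strict Implicit.
Unset Printing Implicit Defensive.

Import Order.TTheory GRing.Theory Num.Theory.

Local Open Scope classical_set_scope.
Local Open Scope ring_scope.

(** * Integration over powers of a probability space *)

Lemma tuple_maskE (T : Type) n (m : bitseq) (x : n.-tuple T) :
  mask m x = [seq tnth x i | i <- mask m (enum 'I_n)].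
Proof. by rewrite map_mask map_tnth_enum. Qed.

Section power_integral.
Context d (T : measurableType d) (R : realType) (mu : probability T R).
Local Open Scope ereal_scope.

Lemma measurable_cons_section n (f : n.+1.-tuple T -> \bar R) (t : T) :
  measurable_fun [set: n.+1.-tuple T] f ->
  measurable_fun [set: n.-tuple T] (fun x : n.-tuple T => f [tuple of t :: x]).
Proof.
move=> mf; apply: (measurableT_comp mf).
by apply: measurable_cons => //; exact: measurable_cst.
Qed.

Lemma measurable_power_integral n (f : n.+1.-tuple T -> \bar R) :
  measurable_fun [set: n.+1.-tuple T] f -> (forall x, 0 <= f x) ->
  measurable_fun [set: T]
    (fun t => \int[power_measure mu n]_x f [tuple of t :: x]).
Proof.
move=> mf f0.
apply: (measurable_fun_fubini_tonelli_F (f \o @tuple_cons d T n)); last by move=> x; exact: f0.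
by apply: measurableT_comp => //; exact: measurable_funPT.
Qed.

Lemma ge0_integral_power_measureS n (f : n.+1.-tuple T -> \bar R) :
  measurable_fun [set: n.+1.-tuple T] f -> (forall x, 0 <= f x) ->
  \int[power_measure mu n.+1]_x f x =
  \int[mu]_t \int[power_measure mu n]_x f [tuple of t :: x].
Proof.
move=> mf f0.
transitivity (\int[mu \x power_measure mu n]_z (f \o @tuple_cons d T n) z).
  rewrite [LHS]ge0_integral_pushforward//; exact: measurable_funPT.
rewrite fubini_tonelli1//; last by move=> x; exact: f0.
by apply: measurableT_comp => //; exact: measurable_funPT.
Qed.

Lemma integral_power_measure0 (f : 0.-tuple T -> \bar R) :
  (forall x, 0 <= f x) -> \int[power_measure mu 0]_x f x = f [tuple].
Proof.
move=> f0; rewrite (eq_integral (cst (f [tuple]))).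
  by rewrite integral_cst//= diracT mule1.
by move=> x _; rewrite tuple0.
Qed.

(** The positions kept depend on [m] alone, so masking reads a fixed list of coordinates. Their
    number varies with [m], hence [h] takes sequences. *)
Lemma measurable_tuple_mask n (m : bitseq) (h : seq T -> \bar R) :
  (forall p, measurable_fun [set: p.-tuple T] (fun x : p.-tuple T => h x)) ->
  measurable_fun [set: n.-tuple T] (fun x : n.-tuple T => h (mask m x)).
Proof.
move=> mh; pose s := in_tuple (mask m (enum 'I_n)).
rewrite (_ : (fun _ => _) = (fun x : _.-tuple T => h x) \o
    (fun x : n.-tuple T => map_tuple (tnth x) s)).
  apply: (measurableT_comp (mh _)); apply/measurable_fun_tnthP => j.
  rewrite (_ : _ \o _ = (fun x : n.-tuple T => tnth x (tnth s j))).
    exact: measurable_tnth.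
  by apply/funext => x /=; rewrite tnth_map.
by apply/funext => x /=; rewrite tuple_maskE.
Qed.

Lemma emeasurable_prod d' (X : measurableType d') (I : Type) (r : seq I)
    (h : I -> X -> \bar R) :
  (forall i, measurable_fun [set: X] (h i)) ->
  measurable_fun [set: X] (fun x => \prod_(i <- r) h i x).
Proof.
move=> mh; elim: r => [|i r ih].
  by under eq_fun do rewrite big_nil; exact: measurable_cst.
by under eq_fun do rewrite big_cons; exact: emeasurable_funM.
Qed.

(* Integrating out the coordinates one at a time, the coordinate t of colour a
   only occurs in g a, the other factors being constants with respect to t. *)
Lemma integral_power_measure_prod (I : eqType) (r : seq I) (c : seq I)
    (g : I -> seq T -> \bar R) :
  uniq r -> {subset c <= r} ->
  (forall i n, measurable_fun [set: n.-tuple T] (fun x : n.-tuple T => g i x)) ->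
  (forall i s, 0 <= g i s) ->
  \int[power_measure mu (size c)]_x
    \prod_(i <- r) g i (mask [seq j == i | j <- c] x) =
  \prod_(i <- r) \int[power_measure mu (count_mem i c)]_x g i x.
Proof.
move=> ur; elim: c g => [|a c ih] g cr mg g0.
  rewrite integral_power_measure0; last by move=> x; exact: prode_ge0.
  by apply: eq_bigr => i _; rewrite integral_power_measure0.
have ar : a \in r by apply: cr; rewrite mem_head.
pose J n (h : seq T -> \bar R) := \int[power_measure mu n]_x h x.
have J0 n h : (forall s, 0 <= h s) -> 0 <= J n h by move=> h0; exact: integral_ge0.
(* Fixing the first coordinate [t] turns [g] into another admissible family, which is why the
   induction quantifies over [g]. *)
pose g' t i := if i == a then fun s => g a (t :: s) else g i.
have g'0 t i s : 0 <= g' t i s by rewrite /g'; case: ifP.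
have mg' t i n : measurable_fun [set: n.-tuple T] (fun x : n.-tuple T => g' t i x).
  rewrite /g'; case: ifP => // _.
  exact: (@measurable_cons_section _ (fun x : n.+1.-tuple T => g a x)).
rewrite [LHS]ge0_integral_power_measureS; last first.
- by move=> x; exact: prode_ge0.
- apply: emeasurable_prod => i.
  exact: (@measurable_tuple_mask (size c).+1 _ (g i)).
transitivity (\int[mu]_t (J (count_mem a c) (fun s => g a (t :: s)) *
    \prod_(i <- r | i != a) J (count_mem i c) (g i))).
  apply: eq_integral => t _.
  transitivity (\prod_(i <- r) J (count_mem i c) (g' t i)).
    rewrite /J -ih//; last by move=> i ic; apply: cr; rewrite in_cons ic orbT.
    apply: eq_integral => x _; apply: eq_bigr => i _ /=.
    by rewrite /g' [i == a]eq_sym; case: eqVneq => // ->.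
  rewrite (bigD1_seq a)//= /g' eqxx; congr (_ * _).
  by apply: eq_bigr => i /negbTE ->.
rewrite ge0_integralZr//; last 3 first.
- exact: (@measurable_power_integral _ (fun x : _.+1.-tuple T => g a x)).
- by move=> t _; exact: J0.
- by apply: prode_ge0 => i _; exact: J0.
rewrite -[RHS]/(\prod_(i <- r) J (count_mem i (a :: c)) (g i)).
rewrite [RHS](bigD1_seq a)//= eqxx; congr (_ * _).
  by rewrite /J [RHS](@ge0_integral_power_measureS _ (fun x => g a x)).
by apply: eq_bigr => i; rewrite eq_sym => /negbTE ->.
Qed.

End power_integral.

(** * Components of a disjoint union *)

Section dunion_theory.
Context (I : pointedType) (d : I -> measure_display)
  (S : forall i, measurableType (d i)).

Lemma measurable_dunion_in i : measurable_fun [set: S i] (dunion_in S i).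
Proof. by move=> _ B mB; rewrite setTI; exact: mB. Qed.

Definition component i : set (dunion S) := [set x | tag x = i].

Lemma dunion_in_component i : dunion_in S i @^-1` component i = setT.
Proof. by apply/seteqP; split. Qed.

Lemma dunion_in_componentN i j : j <> i -> dunion_in S j @^-1` component i = set0.
Proof. by move=> ji; apply/seteqP; split. Qed.

Lemma measurable_component i : measurable (component i).
Proof.
move=> j; have [->|/eqP ji] := eqVneq j i; first by rewrite dunion_in_component.
by rewrite dunion_in_componentN.
Qed.

(** A total left inverse of the injection: off component [i], [tagged_as] falls back on [point]. *)
Definition dunion_out i (x : dunion S) : S i :=
  tagged_as (dunion_in S i point) x.

Lemma dunion_inK i : cancel (dunion_in S i) (dunion_out i).
Proof. by move=> x; exact: (@tagged_asE _ _ (dunion_in S i point)). Qed.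

Lemma dunion_outK i x : tag x = i -> dunion_in S i (dunion_out i x) = x.
Proof. by case: x => j y /= <-; rewrite [dunion_out _ _]dunion_inK. Qed.

(** Pulled back to component [j], the map is the identity if [j = i] and constant otherwise. *)
Lemma measurable_dunion_out i : measurable_fun [set: dunion S] (dunion_out i).
Proof.
move=> _ B mB; rewrite setTI.
suff: dunion_measurable (dunion_out i @^-1` B) by [].
move=> j; rewrite -comp_preimage.
have [->|ji] := eqVneq j i.
  by rewrite (_ : _ \o _ = id)//; apply/funext => x /=; rewrite dunion_inK.
rewrite (_ : _ \o _ = cst point).
  by have := @measurable_cst _ _ (S j) (S i) setT point measurableT _ mB; rewrite setTI.
apply/funext => x; rewrite /= /dunion_out /tagged_as /=.
by case: eqP => // e; rewrite e eqxx in ji.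
Qed.

End dunion_theory.

(** * The kernel of a direct sum *)

Section dsum_kernel_theory.
Context (I : pointedType) (d : I -> measure_display)
  (S : forall i, measurableType (d i)) (R : realType) (eta : I -> R)
  (W : forall i, S i * S i -> R).

Lemma dsum_kernel_in i (x y : S i) :
  dsum_kernel eta W (dunion_in S i x, dunion_in S i y) = W (x, y).
Proof.
rewrite /dsum_kernel /= eqxx; congr (W (_, _)).
exact: (@tagged_asE _ _ (dunion_in S i x)).
Qed.

Lemma dsum_kernel_neq x y : tag x != tag y ->
  dsum_kernel eta W (x, y) = if eta (tag x) < eta (tag y) then 1 else 0.
Proof. by rewrite /dsum_kernel /= => /negbTE ->. Qed.

Lemma dsum_kernel_ge0 : (forall i z, 0 <= W (i:=i) z) ->
  forall z, 0 <= dsum_kernel eta W z.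
Proof. by move=> W0 z; rewrite /dsum_kernel; case: ifP => // _; case: ifP. Qed.

(** Since [I] is countable, preimages can be cut along the products of two components. On the
    diagonal products the kernel is some [W i]; on the others it is constant. *)
Lemma measurable_dsum_kernel : countable [set: I] ->
  (forall i, measurable_fun [set: S i * S i] (@W i)) ->
  measurable_fun [set: dunion S * dunion S] (dsum_kernel eta W).
Proof.
move=> cI mW _ B mB; rewrite setTI.
rewrite (_ : _ @^-1` _ = \bigcup_i \bigcup_j
    (component i `*` component j `&` dsum_kernel eta W @^-1` B)); last first.
  apply/seteqP; split => [z Bz|z [i _ [j _ []]]//].
  by exists (tag z.1) => //; exists (tag z.2).
apply: countable_bigcupT_measurable => // i.
apply: countable_bigcupT_measurable => // j.
have mij : measurable (component i `*` component j : set (dunion S * dunion S)).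
  by apply: measurableX; exact: measurable_component.
have [<-|ij] := eqVneq i j.
  rewrite (_ : _ `&` _ = component i `*` component i `&`
      (@W i \o (fun z => (dunion_out i z.1, dunion_out i z.2))) @^-1` B).
    apply: measurableI; first by apply: measurableX; exact: measurable_component.
    rewrite -[X in measurable X]setTI; apply: (measurableT_comp (mW i)) => //.
    apply: measurable_fun_pair; apply: measurableT_comp => //;
      exact: measurable_dunion_out.
  have WE x y : tag x = i -> tag y = i ->
      dsum_kernel eta W (x, y) = W (dunion_out i x, dunion_out i y).
    move=> xi yi; rewrite -[in LHS](dunion_outK xi) -[in LHS](dunion_outK yi).
    exact: dsum_kernel_in.
  by apply/seteqP; split => -[x y] /= [[xi yi]]; rewrite WE.
pose v : R := if eta i < eta j then 1 else 0.
rewrite (_ : _ `&` _ = component i `*` component j `&` cst v @^-1` B).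
  by have := @measurable_cst _ _ (dunion S * dunion S)%type R _ v mij _ mB.
by apply/seteqP; split => -[x y] /= [[xi yj]];
  rewrite dsum_kernel_neq xi yj.
Qed.

End dsum_kernel_theory.

(** * Restriction of integrals to one component *)

Section dsum_integral.
Context (I : pointedType) (d : I -> measure_display)
  (S : forall i, measurableType (d i)) (R : realType)
  (alpha : I -> R) (alpha_ge0 : forall i, 0 <= alpha i)
  (alpha_sum : (\esum_(i in [set: I]) (alpha i)%:E = 1)%E)
  (mu : forall i, probability (S i) R).
Local Open Scope ereal_scope.

Local Notation m := (dsum_measure alpha_ge0 alpha_sum mu).

(** The preimages of [A] in the other components are empty, so one term of the sum survives. *)
Lemma dsum_measure_component i (A : set (dunion S)) : A `<=` component i ->
  m A = (alpha i)%:E * mu i (dunion_in S i @^-1` A).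
Proof.
move=> Ai; rewrite /dsum_measure esum_mkcond.
rewrite -(@esum_set1 _ _ i (fun i => (alpha i)%:E * mu i (dunion_in S i @^-1` A))).
  rewrite [RHS]esum_mkcond; apply: eq_esum => j _.
  rewrite in_setT; case: ifPn => //; rewrite notin_setE /= => ji.
  rewrite (_ : _ @^-1` A = set0) ?measure0 ?mule0//.
  by apply/seteqP; split => // x /Ai.
by rewrite mule_ge0// lee_fin.
Qed.

(** On subsets of component [i] the direct sum measure is [alpha i] times the image of [mu i], and
    [f] vanishes elsewhere. *)
Lemma integral_dsum_component i (f : dunion S -> \bar R) :
  measurable_fun [set: dunion S] f -> (forall x, 0 <= f x) ->
  (forall x, tag x <> i -> f x = 0) ->
  \int[m]_x f x = (alpha i)%:E * \int[mu i]_y f (dunion_in S i y).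
Proof.
move=> mf f0 fi.
have mi := measurable_component S i.
have mfi : measurable_fun (component i) f by exact: measurable_funTS.
transitivity (\int[m]_(x in component i) f x).
  rewrite [RHS]integral_mkcond; apply: eq_integral => x _.
  by rewrite patchE; case: ifPn => //; rewrite notin_setE => /fi.
pose k := NngNum (alpha_ge0 i).
pose phi : {mfun S i >-> dunion S} := HB.pack (dunion_in S i)
  (isMeasurableFun.Build _ _ _ _ (dunion_in S i) (measurable_dunion_in (i := i))).
rewrite (eq_measure_integral (mscale k (distribution (mu i) phi))).
  rewrite ge0_integral_mscale// ge0_integral_pushforward//.
  by rewrite dunion_in_component.
by move=> A mA Ai; exact: dsum_measure_component.
Qed.

(** Coordinates are integrated out one at a time; each is confined to component [i] and yields one
    factor [alpha i]. *)
Lemma integral_power_dsum_component i n (f : n.-tuple (dunion S) -> \bar R) :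
  measurable_fun [set: n.-tuple (dunion S)] f -> (forall x, 0 <= f x) ->
  (forall x, (exists j, tag (tnth x j) <> i) -> f x = 0) ->
  \int[power_measure m n]_x f x =
  (alpha i ^+ n)%:E * \int[power_measure (mu i) n]_y f (map_tuple (dunion_in S i) y).
Proof.
elim: n f => [|n ih] f mf f0 fi.
  rewrite !integral_power_measure0// expr0 mul1e; congr f; exact/esym/tuple0.
rewrite ge0_integral_power_measureS// (@integral_dsum_component i)//; last 3 first.
- exact: measurable_power_integral.
- by move=> t; exact: integral_ge0.
- move=> t ti; apply: integral0_eq => x _; apply: fi.
  by exists ord0; rewrite (tnth_nth t).
pose F (y : n.+1.-tuple (S i)) := f (map_tuple (dunion_in S i) y).
have mF : measurable_fun [set: n.+1.-tuple (S i)] F.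
  apply: (measurableT_comp mf); apply/measurable_fun_tnthP => j.
  rewrite (_ : _ \o _ = dunion_in S i \o (fun y : n.+1.-tuple (S i) => tnth y j)).
    apply: measurableT_comp; last exact: measurable_tnth.
    exact: measurable_dunion_in.
  by apply/funext => y; rewrite /= tnth_map.
rewrite [in RHS](@ge0_integral_power_measureS _ _ _ _ _ F)//; last by move=> y; exact: f0.
rewrite exprS EFinM -muleA; congr (_ * _).
rewrite -ge0_integralZl//; last 3 first.
- by apply: measurable_power_integral => // y; exact: f0.
- by move=> t _; apply: integral_ge0 => y _; exact: f0.
- by rewrite lee_fin exprn_ge0.
apply: eq_integral => t _.
rewrite ih//.
- by congr (_ * _); apply: eq_integral => y _; congr f; exact: val_inj.
- exact: measurable_cons_section.
- move=> x [j xj]; apply: fi; exists (lift ord0 j).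
  by rewrite (tnth_nth (tnth x j)) /= -tnth_nth.
Qed.

End dsum_integral.

(** * Countable partitions, tuples and the empty tournament *)

Lemma ge0_integral_countable_partition d (T : measurableType d) (R : realType)
    (mu : {measure set T -> \bar R}) (I : choiceType) (F : I -> set T)
    (f : T -> \bar R) :
  countable [set: I] -> (forall i, measurable (F i)) ->
  (forall i j x, F i x -> F j x -> i = j) -> (forall x, exists i, F i x) ->
  measurable_fun [set: T] f -> (forall x, 0 <= f x)%E ->
  (\int[mu]_x f x = \esum_(i in [set: I]) \int[mu]_(x in F i) f x)%E.
Proof.
move=> /countable_injP[g ginj] mF tF cF mf f0.
have {}ginj : injective g by move=> i j; apply: ginj; rewrite in_setT.
(* The injection [g] turns the family into a sequence, with the empty set at numbers outside its
   range, so that countable additivity applies. *)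
pose G n := \bigcup_(i in [set i | g i = n]) F i.
have GE i : G (g i) = F i.
  by apply/seteqP; split => [x [j /= /ginj ->]//|x Fx]; exists i.
have GN n : ~ (exists i, g i = n) -> G n = set0.
  by move=> nn; apply/seteqP; split => // x [i /= gi _]; apply: nn; exists i.
have mG n : measurable (G n).
  by have [[i <-]|/GN ->] := pselect (exists i, g i = n); rewrite ?GE.
have GT : \bigcup_n G n = setT.
  apply/seteqP; split => // x _; have [i Fx] := cF x.
  by exists (g i) => //; rewrite GE.
have tG : trivIset [set: nat] G.
  apply/trivIsetP => a b _ _ ab; apply/seteqP; split => // x [[i /= gi Fi] [j /= gj Fj]].
  by move: ab; rewrite -gi -gj (tF _ _ _ Fi Fj) eqxx.
rewrite -[X in (\int[_]_(x in X) _)%E]GT ge0_integral_bigcup//; last by rewrite GT.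
rewrite nneseries_esumT; last by move=> n; exact: integral_ge0.
transitivity (\esum_(n in [set g i | i in [set: I]]) \int[mu]_(x in G n) f x)%E.
  rewrite [RHS]esum_mkcond; apply: eq_esum => n _; case: ifPn => //.
  rewrite notin_setE => nn; rewrite GN ?integral_set0// => -[i gi].
  by apply: nn; exists i.
rewrite esum_image; first by apply: eq_esum => i _; rewrite GE.
by move=> i j _ _; exact: ginj.
Qed.

Lemma countable_tuple (T : Type) n : countable [set: T] -> countable [set: n.-tuple T].
Proof.
move=> /countable_injP[g ginj]; apply/countable_injP.
exists (fun c => choice.pickle (map_tuple g c)) => x y _ _.
move=> /(pcan_inj choice.pickleK) /(congr1 val)/= /inj_map e; apply/val_inj/e.
by move=> a b; apply: ginj; rewrite in_setT.
Qed.

(** Serves functions defined on sequences of any length: an out-of-range index gives the constant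
    [x0]. *)
Lemma measurable_tuple_nth d (T : measurableType d) n (x0 : T) j :
  measurable_fun [set: n.-tuple T] (fun x : n.-tuple T => nth x0 x j).
Proof.
have [jn|nj] := ltnP j n.
  rewrite (_ : (fun _ => _) = (fun x => tnth x (Ordinal jn))).
    exact: measurable_tnth.
  by apply/funext => x; rewrite (tnth_nth x0).
rewrite (_ : (fun _ => _) = cst x0); first exact: measurable_cst.
by apply/funext => x; rewrite nth_default// size_tuple.
Qed.

(** The size is tied to 0 by an equation because the cardinal of an empty colour class is 0 by
    proof, not by computation. *)
Lemma t_ind_empty d (T : measurableType d) (R : realType) (mu : probability T R)
  n (F : tournament n) (W : T * T -> R) : n = 0%N -> t_ind mu F W = 1%E.
Proof.
move=> n0; subst n.
have W1 (x : 0.-tuple T) : \prod_(e : 'I_0 * 'I_0 | F e.1 e.2)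
    W (tnth x e.1, tnth x e.2) = 1 by apply: big1 => -[[]].
rewrite /t_ind integral_power_measure0; first by rewrite W1.
by move=> x; rewrite W1.
Qed.

(** * Colour classes of a colouring *)

Section color_class.
Context (k : nat) (Q : eqType) (c : k.-tuple Q).

Definition color_class (i : Q) : {set 'I_k} := [set v | tnth c v == i].

(** Masking keeps the vertices in increasing order, so it agrees with the relabelling in
    [induced_sub]. *)
Lemma enum_color_class i :
  mask [seq j == i | j <- c] (enum 'I_k) = enum (color_class i).
Proof.
rewrite -[in LHS](map_tnth_enum c) -map_comp -filter_mask.
rewrite /enum_mem filter_predT; apply: eq_filter => v.
by rewrite /= inE.
Qed.

Lemma count_color i : count_mem i c = #|color_class i|.
Proof.
rewrite -[in LHS](map_tnth_enum c) count_map cardE -enum_color_class.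
by rewrite -[in RHS](map_tnth_enum c) -map_comp -filter_mask size_filter.
Qed.

Lemma nth_mask_color_class (T : Type) (x0 : T) (x : k.-tuple T) i
    (j : 'I_#|color_class i|) :
  nth x0 (mask [seq j == i | j <- c] x) j = tnth x (enum_val j).
Proof.
rewrite tuple_maskE enum_color_class (nth_map (enum_val j)) -?enum_val_nth//.
by rewrite -cardE.
Qed.

(** Every vertex lies in exactly one class, and [undup c] lists each colour in use once. *)
Lemma prod_color_class (R : comPzRingType) (h : 'I_k -> R) :
  \prod_(i <- undup c) \prod_(v in color_class i) h v = \prod_v h v.
Proof.
rewrite (exchange_big_dep predT)//=; apply: eq_bigr => v _.
rewrite big_mkcond (bigD1_seq (tnth c v)) ?undup_uniq ?mem_undup ?mem_tnth//=.
rewrite inE eqxx big1 ?mulr1// => i.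
by rewrite inE eq_sym => /negbTE ->.
Qed.

End color_class.

(** * The integral over one cell *)

Section cells.
Context (R : realType) (Q : pointedType)
  (d : Q -> measure_display) (S : forall i : Q, measurableType (d i))
  (mu : forall i : Q, probability (S i) R)
  (W : forall i : Q, S i * S i -> R)
  (alpha : Q -> R) (alpha_ge0 : forall i : Q, 0 <= alpha i)
  (alpha_sum : (\esum_(i in [set: Q]) (alpha i)%:E = 1)%E)
  (eta : Q -> R)
  (Q_countable : countable [set: Q])
  (mW : forall i, measurable_fun [set: S i * S i] (@W i))
  (W_ge0 : forall i z, 0 <= @W i z).

Local Notation T := (dunion S).
Local Notation m := (dsum_measure alpha_ge0 alpha_sum mu).
Local Notation K := (dsum_kernel eta W).

(* Defined on sequences of any length, as required by
   [integral_power_measure_prod]; out-of-range indices read [point]. *)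
Definition block_density i n (E : rel 'I_n) (s : seq T) : R :=
  \prod_(e : 'I_n * 'I_n | E e.1 e.2) K (nth point s e.1, nth point s e.2) *
  \prod_(j < n) \1_(component i) (nth point s j).

Let K_ge0 z : 0 <= K z.
Proof. exact: dsum_kernel_ge0. Qed.

Lemma block_density_ge0 i n (E : rel 'I_n) s : 0 <= block_density i E s.
Proof.
by apply: mulr_ge0; apply: prodr_ge0 => e _; rewrite ?K_ge0// indicE ler0n.
Qed.

Lemma measurable_block_density i n (E : rel 'I_n) p :
  measurable_fun [set: p.-tuple T] (fun x : p.-tuple T => block_density i E x).
Proof.
apply: measurable_funM.
  under eq_fun do rewrite big_mkcond.
  apply: measurable_prod => e _; case: (E e.1 e.2); last exact: measurable_cst.
  apply: (measurableT_comp (measurable_dsum_kernel eta Q_countable mW)).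
  by apply: measurable_fun_pair; exact: measurable_tuple_nth.
apply: measurable_prod => j _.
apply: measurableT_comp; last exact: measurable_tuple_nth.
exact/measurable_indic/measurable_component.
Qed.

(** The indicators in [block_density] confine all coordinates to component [i], where the kernel is
    [W i]. *)
Lemma integral_block_density i n (F : tournament n) :
  (\int[power_measure m n]_x (block_density i F x)%:E =
   (alpha i ^+ n)%:E * t_ind (mu i) F (@W i))%E.
Proof.
rewrite (@integral_power_dsum_component _ _ _ _ _ _ _ _ i); last 3 first.
- apply/measurable_EFinP; exact: measurable_block_density.
- by move=> x; rewrite lee_fin block_density_ge0.
- move=> x [j xj]; congr EFin; rewrite /block_density.
  rewrite [X in _ * X](bigD1 j)//= -tnth_nth indicE memNset// mul0r mulr0//.
congr (_ * _)%E; apply: eq_integral => y _; congr EFin.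
rewrite /block_density [X in _ * X]big1 ?mulr1.
  apply: eq_bigr => e _.
  by rewrite -!tnth_nth !tnth_map dsum_kernel_in.
by move=> j _; rewrite -tnth_nth tnth_map indicE mem_set.
Qed.

Context (k : nat) (F : tournament k) (eta_inj : injective eta).

Definition cell (c : k.-tuple Q) : set (k.-tuple T) :=
  [set x | forall v, tag (tnth x v) = tnth c v].

(** Only pairs of distinct colours are constrained; edges inside a class are free. *)
Definition monotone_coloring (c : k.-tuple Q) : Prop :=
  forall u v, eta (tnth c u) < eta (tnth c v) -> F u v.

Local Notation density x :=
  (\prod_(e : 'I_k * 'I_k | F e.1 e.2) K (tnth x e.1, tnth x e.2)).

Lemma measurable_cell c : measurable (cell c).
Proof.
rewrite (_ : cell c = \bigcap_(v in [set: 'I_k])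
    ((fun x : k.-tuple T => tnth x v) @^-1` component (tnth c v))).
  apply: fin_bigcap_measurable => // v _.
  rewrite -[X in measurable X]setTI.
  by apply: measurable_tnth => //; exact: measurable_component.
by apply/seteqP; split => [x h v _|x h v]; [exact: (h v)|exact: (h v Logic.I)].
Qed.

Lemma measurable_density :
  measurable_fun [set: k.-tuple T] (fun x : k.-tuple T => density x).
Proof.
under eq_fun do rewrite big_mkcond.
apply: measurable_prod => e _; case: (F e.1 e.2); last exact: measurable_cst.
apply: (measurableT_comp (measurable_dsum_kernel eta Q_countable mW)).
by apply: measurable_fun_pair; exact: measurable_tnth.
Qed.

(** Some edge goes from [v] to [u] although the colour of [u] precedes that of [v]; its factor is
    0. *)
Lemma density_non_monotone c (x : k.-tuple T) :
  ~ monotone_coloring c -> cell c x -> density x = 0.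
Proof.
move=> /existsNP[u] /existsNP[v] /not_implyP[uv /negP Fuv] cx.
have cvu : tnth c v != tnth c u.
  by apply/eqP => e; move: uv; rewrite e ltxx.
have Fvu : F v u.
  by rewrite edge_total//; apply: contraNneq cvu => ->.
rewrite (bigD1 (v, u))//= dsum_kernel_neq !cx//.
by rewrite ltNge (ltW uv)/= mul0r.
Qed.

(** On the cell, edges between classes follow the order of the colours and contribute 1, which
    leaves the edges inside classes. The component indicators of the blocks multiply to the
    indicator of the cell. *)
Lemma density_monotone c (x : k.-tuple T) :
  monotone_coloring c ->
  density x * \1_(cell c) x =
  \prod_(i <- undup c) block_density i (induced_sub F (color_class c i))
    (mask [seq j == i | j <- c] x).
Proof.
move=> mc.
(* Non-edges count as 1, so the product over edges becomes one over all pairs of vertices, which can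
   be sorted by class. *)
pose H u v := if F u v then K (tnth x u, tnth x v) else 1.
have blockE i : block_density i (induced_sub F (color_class c i))
    (mask [seq j == i | j <- c] x) =
  (\prod_(u in color_class c i) \prod_(v in color_class c i) H u v) *
  \prod_(v in color_class c i) \1_(component i) (tnth x v).
  rewrite /block_density; congr (_ * _).
    rewrite big_mkcond -(pair_bigA _ (fun a b => if F (enum_val a) (enum_val b)
      then K (nth point (mask [seq j == i | j <- c] x) a,
              nth point (mask [seq j == i | j <- c] x) b) else 1)) /=.
    rewrite [RHS]big_enum_val; apply: eq_bigr => a _.
    rewrite [RHS]big_enum_val; apply: eq_bigr => b _.
    by rewrite !nth_mask_color_class.
  rewrite [RHS]big_enum_val; apply: eq_bigr => a _.
  by rewrite nth_mask_color_class.
under eq_bigr do rewrite blockE.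
(* Off the cell both sides vanish: a coordinate in the wrong component kills the block of its
   assigned colour. *)
have [cx|cx] := pselect (cell c x); last first.
  have /existsNP[v xv] := cx.
  rewrite indicE memNset// mulr0.
  rewrite (bigD1_seq (tnth c v)) ?undup_uniq ?mem_undup ?mem_tnth//=.
  rewrite [X in _ * X * _](bigD1 v) ?inE//= indicE memNset//.
  by rewrite mul0r mulr0 mul0r.
rewrite indicE mem_set// mulr1 big_split/=.
rewrite [X in _ * X]big1 ?mulr1; last first.
  move=> i _; apply: big1 => v; rewrite inE => /eqP cv.
  by rewrite indicE mem_set// /component /= cx.
rewrite big_mkcond -(pair_bigA _ H) /=.
(* For each [u], the factors of the [v] of another colour are 1. *)
transitivity (\prod_u \prod_(v in color_class c (tnth c u)) H u v).
  apply: eq_bigr => u _; rewrite [RHS]big_mkcond; apply: eq_bigr => v _.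
  rewrite inE; case: eqVneq => // vu; rewrite /H; case: ifP => // Fuv.
  rewrite dsum_kernel_neq !cx 1?eq_sym//.
  (* A smaller colour at [v] would force the edge from [v] to [u], against [F u v]; equality is
     excluded by injectivity of [eta]. *)
  case: ltgtP => // [/mc Fvu|/eta_inj e]; last by rewrite e eqxx in vu.
  have uv : u != v by apply: contraNneq vu => ->.
  by move: Fuv; rewrite edge_total// Fvu.
rewrite -(prod_color_class c); apply: eq_bigr => i _.
by apply: eq_bigr => u; rewrite inE => /eqP ->.
Qed.

(** Once the indicator of the cell is absorbed into the blocks, the integral factors because
    distinct blocks read disjoint sets of coordinates. *)
Lemma integral_cell_monotone c : monotone_coloring c ->
  (\int[power_measure m k]_(x in cell c) (density x)%:E =
   \big[*%E/1]_(i \in [set: Q]) ((alpha i ^+ #|color_class c i|)%:E *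
      t_ind (mu i) (induced_sub F (color_class c i)) (@W i)))%E.
Proof.
move=> mc.
transitivity (\int[power_measure m k]_x \prod_(i <- undup c)
    (block_density i (induced_sub F (color_class c i))
      (mask [seq j == i | j <- c] x))%:E)%E.
  rewrite [LHS]integral_mkcond; apply: eq_integral => x _.
  rewrite prodEFin -density_monotone// patchE indicE.
  by case: ifPn; rewrite ?mulr1 ?mulr0.
pose J n (h : seq T -> \bar R) := (\int[power_measure m n]_x h x)%E.
rewrite [LHS](_ : _ = \prod_(i <- undup c) J (count_mem i c)
    (fun s => (block_density i (induced_sub F (color_class c i)) s)%:E))%E.
  rewrite (@fsbigE _ _ _ _ _ (undup c)) ?undup_uniq//.
    apply: eq_big => [i|i _]; first by rewrite in_setT.
    by rewrite count_color /J integral_block_density.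
  (* A colour not in use contributes 1, even if its [alpha i] is 0, so the product over [Q] reduces
     to the colours of [c]. *)
  move=> i _; rewrite mem_undup => ic.
  have c0 : #|color_class c i| = 0%N.
    by rewrite -count_color; apply/count_memPn.
  by rewrite t_ind_empty// [X in _ ^+ X]c0 expr0 mule1.
pose g i s := (block_density i (induced_sub F (color_class c i)) s)%:E.
have := @integral_power_measure_prod _ _ _ m Q (undup c) c g (undup_uniq _).
rewrite size_tuple; apply.
- by move=> i; rewrite mem_undup.
- by move=> i n; apply/measurable_EFinP; exact: measurable_block_density.
- by move=> i s; rewrite lee_fin block_density_ge0.
Qed.

(** The inverse colours each vertex by the only index whose member contains it. Finiteness of a
    family of classes comes from [c] having finitely many entries. *)
Lemma split_families_coloring :
  set_bij monotone_coloring (split_families F eta) (@color_class k Q).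
Proof.
split.
- move=> c mc; split.
  + apply: (@sub_finite_set _ _ [set` undup c]) => [i /= ci|]; last exact: finite_seq.
    rewrite mem_undup; apply/negPn/negP => ic; apply: ci.
    apply/setP => v; rewrite !inE; apply/negbTE.
    by apply: contra ic => /eqP <-; exact: mem_tnth.
  + move=> i j ij; apply/setP => v; rewrite !inE; apply/negbTE/negP.
    by move=> /andP[/eqP -> /eqP].
  + by move=> v; exists (tnth c v); rewrite inE.
  + by move=> i j ij u v; rewrite !inE => /eqP ci /eqP cj; apply: mc; rewrite ci cj.
- move=> c c' _ _ cc'; apply: eq_from_tnth => v; apply/esym/eqP.
  have : v \in color_class c (tnth c v) by rewrite inE.
  by rewrite cc' inE.
- move=> A [_ Adisj Acov Amono]; have [f fP] := choice Acov.
  have AE : color_class [tuple f v | v < k] = A.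
    apply/funext => i; apply/setP => v; rewrite inE tnth_mktuple.
    apply/eqP/idP => [<-//|vi]; apply/eqP/negPn/negP => /eqP/Adisj/setP/(_ v).
    by rewrite !inE fP vi.
  exists [tuple f v | v < k] => // u v.
  by rewrite !tnth_mktuple => uv; apply: (Amono _ _ uv).
Qed.

End cells.

(** * Summation over the cells *)

Theorem theorem6p13 (R : realType) (Q : pointedType)
    (Q_countable : countable [set: Q])
    (d : Q -> measure_display) (S : forall i : Q, measurableType (d i))
    (mu : forall i : Q, probability (S i) R)
    (W : forall i : Q, S i * S i -> R)
    (W_kernel : forall i : Q, tournament_kernel (mu i) (W i))
    (alpha : Q -> R) (alpha_ge0 : forall i : Q, 0 <= alpha i)
    (alpha_sum : (\esum_(i in [set: Q]) (alpha i)%:E = 1)%E)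
    (eta : Q -> R) (eta_01 : forall i : Q, 0 <= eta i <= 1)
    (eta_inj : injective eta)
    (k : nat) (F : tournament k) :
  (t_ind (dsum_measure alpha_ge0 alpha_sum mu) F (dsum_kernel eta W) =
   \esum_(A in split_families F eta)
     \big[*%E/1]_(i \in [set: Q])
       ((alpha i ^+ #|A i|)%:E * t_ind (mu i) (induced_sub F (A i)) (W i)))%E.
Proof.
have mW i : measurable_fun [set: S i * S i] (W i) by case: (W_kernel i).
have W_ge0 i z : 0 <= W i z by case: (W_kernel i) => _ /(_ z)/andP[].
(* Both sides become sums over colourings: the right one over the monotone ones, the left one over
   all. *)
rewrite (reindex_esum _ _ _ _ (split_families_coloring eta F)).
rewrite /t_ind (@ge0_integral_countable_partition _ _ _ _ _ (@cell _ _ S k)).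
- rewrite [RHS]esum_mkcond; apply: eq_esum => c _; case: ifPn.
    by rewrite inE => mc; exact: integral_cell_monotone.
  (* The remaining cells contribute 0, matching the terms absent on the right. *)
  rewrite notin_setE => mc; apply: integral0_eq => x cx; congr EFin.
  exact: density_non_monotone mc cx.
- exact: countable_tuple.
- exact: measurable_cell.
- by move=> c c' x xc xc'; apply: eq_from_tnth => v; rewrite -xc -xc'.
(* A point lies in the cell of the colouring that records the components of its coordinates. *)
- move=> x; exists (map_tuple (fun t : dunion S => tag t) x) => v.
  by rewrite tnth_map.
- apply/measurable_EFinP; exact: measurable_density.
- by move=> x; rewrite lee_fin prodr_ge0// => e _; exact: dsum_kernel_ge0.
Qed.
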